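(* Let $U$, $L$, $T$, $P_{\sum}$, $\pi'_{\Omega}$, $P^{*}_T$ and $P^{**}_T$ be as described in the context, and let $P_T$ be a program in $L$ computing a total function (i.e. $U(P_T\circ w)$ halts, with a natural-number output, for every $w\in L$). Then for every $w\in L$, $U(P^{**}_T\circ P_T\circ w)$ is a well-defined value (the computation halts); that is, $w\mapsto U(P^{**}_T\circ P_T\circ w)$ is a total function, and hence $U_{P^{**}_T\circ P_T}$ is a Turing submachine (a total Turing machine).
   Context: $U$ is a universal Turing machine whose programming language $L$ is binary, self-delimiting (prefix-free), recursive, and recursively functionalizable: there is a computable operation $(P,w)\mapsto P\circ w\in L$ such that $U(P\circ w)$ equals the result of running program $P$ on input $w$, it is decidable whether a string has the form $P\circ w$ (and $P$, $w$ can then be recovered), and likewise for iterated concatenations $P\circ w_1\circ\dots\circ w_k$ (program $P$ receiving inputs $w_1,\dots,w_k$). Moreover there are constants $\epsilon, C, C'$ such that for all $P,w_1,\dots,w_k$: $|w_i|<|P\circ w_1\circ\dots\circ w_k|$, $|P\circ w_1\circ\dots\circ w_k|\le Ck+|P|+|w_1|+\dots+|w_k|$, and $H(N)\le C'+\log_2 N+(1+\epsilon)\log_2\log_2 N$, where $H(N)$ is the length of a shortest $L$-program that outputs (a representation of) $N$. A natural number $N$ given as input denotes its representation in $L$. All finite bit strings are computably enumerated as $l_1=0,l_2,l_3,\dots$. $T$ is a program with $U(T\circ p)$ = number of steps $U$ takes to run $p$ (undefined if $U(p)$ does not halt). For a program $Q$ computing a total function (a time bound), the Turing submachine $U_Q$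 is defined by: $U_Q(w)=l_1$ if $U(w)$ does not halt within $U(Q\circ w)$ steps, and $U_Q(w)=l_{k+1}$ if $U(w)$ halts within $U(Q\circ w)$ steps with $U(w)=l_k$. $P_{\sum}$: given $Q\circ N$, $U(P_{\sum}\circ Q\circ N)$ is the (finite binary) sum $\sum 2^{-|p|}$ over programs $p\in L$ with $|p|\le N$ that halt within $U(Q\circ p)$ steps (i.e. $U_Q(p)\ne l_1$); it is $0$ if $N=0$. (It is undefined if $Q$ is not total.) $\pi'_{\Omega}$: on input $Q\circ 0^{|\rho|}1\circ\rho$, where $\rho$ is a finite bit string read as a binary real in $[0,1]$: if $\rho=0$ it returns $0$; otherwise for $n=1,2,\dots$ it computes the sum of $2^{-|p|}$ over programs $p$ of size $\le n$ halting within time $U(Q\circ p)$, until reaching the first $k$ with this sum $\ge\rho$ (never halting if there is none), then returns $1+$ the largest output of $U_Q$ on programs of size $\le k$. $P^{*}_T$: given inputs $Q$, $P_T$, $w$, it returns $U(T\circ w)$ if (i) $w$ is of the form $\pi'_{\Omega}\circ Q\circ 0^{|\rho|}1\circ\rho$ for some $\rho$, and $U(P_{\sum}\circ Q\circ(|\pi'_{\Omega}\circ Q\circ 0^{|\rho|}1\circ\rho|-1))\ge\rho$, and $U(T\circ w)>U(P_T\circ w)$; otherwise (ii) it returns $U(P_T\circ w)$. $P^{**}_T$: a self-referential program which, given $P_T$ and $w$, reads itself, $P_T$ and $w$, assembles $P^{*}_T\circ P^{**}_T\circ P_T\circ P_T\circ w$ and returns its value; i.e. $U(P^{**}_T\circ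 P_T\circ w)=U(P^{*}_T\circ P^{**}_T\circ P_T\circ P_T\circ w)$ (so in the definition of $P^{*}_T$ the role of $Q$ is played by $P^{**}_T\circ P_T$). *)

(* Defs.v *)
From HB Require Import structures.
From mathcomp Require Import all_boot all_order all_algebra.
From mathcomp Require Import reals exp.

Set Implicit Arguments.
Unset Strict Implicit.
Unset Printing Implicit Defensive.

Import Order.TTheory GRing.Theory Num.Theory.

Notation bits := (seq bool).

(** ** Recursive functions *)

(* Kleene's mu-recursive functions.  Arguments form a list of arbitrary length,
   missing arguments being read as 0, so terms carry no arity. *)
Inductive recfun : Type :=
| RZero
| RSucc
| RProj of nat
| RComp of recfun & seq recfun
| RPrec of recfun & recfun
| RMu of recfun.

(* [rsem f xs y]: the partial function denoted by [f] is defined at [xs], with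
   value [y]. *)
Fixpoint rsem (f : recfun) (xs : seq nat) (y : nat) {struct f} : Prop :=
  match f with
  | RZero => y = 0
  | RSucc => y = (head 0 xs).+1
  | RProj i => y = nth 0 xs i
  | RComp g hs =>
      exists2 zs : seq nat,
        (fix args (hs : seq recfun) (zs : seq nat) {struct hs} : Prop :=
           match hs, zs with
           | [::], [::] => True
           | h :: hs', z :: zs' => rsem h xs z /\ args hs' zs'
           | _, _ => False
           end) hs zs
        & rsem g zs y
  | RPrec g h =>
      (fix prec (n : nat) (y : nat) {struct n} : Prop :=
         match n with
         | 0 => rsem g (behead xs) y
         | m.+1 => exists2 z, prec m z & rsem h [:: m, z & behead xs] y
         end) (head 0 xs) y
  | RMu g =>
      rsem g (y :: xs) 0 /\ forall m, m < y -> exists z, rsem g (m :: xs) z.+1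
  end.

(* Bijective base-2 numeration, a bijection from bit strings to [nat]. *)
Fixpoint bcode (s : bits) : nat :=
  if s is b :: s' then (bcode s').*2 + b.+1 else 0.

(* A partial function is given by its graph: [F ws v] means [F(ws) = v]. *)
Definition partial_recursive (k : nat) (F : seq bits -> bits -> Prop) : Prop :=
  exists f : recfun, forall (ws : seq bits) (y : nat), size ws = k ->
    rsem f (map bcode ws) y <-> (exists2 v, F ws v & y = bcode v).

Definition recursive_set (A : bits -> Prop) : Prop :=
  exists f : recfun, forall w : bits,
    (A w /\ forall y, rsem f [:: bcode w] y <-> y = 1)
    \/ (~ A w /\ forall y, rsem f [:: bcode w] y <-> y = 0).

Definition computable_seq (u : nat -> bits) : Prop :=
  exists f : recfun, forall n y, rsem f [:: n] y <-> y = bcode (u n).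

(** ** Turing machines *)

Inductive move : Type := MoveLeft | MoveRight | Stay.

(* One two-way infinite tape; [None] is the blank, [Some (inl b)] the bit [b],
   [Some (inr a)] a work symbol.  The machine halts when no transition
   applies. *)
Record TM : Type := MkTM {
  tm_state : finType;
  tm_work : finType;
  tm_start : tm_state;
  tm_delta : tm_state -> option (bool + tm_work) ->
             option (tm_state * option (bool + tm_work) * move) }.

Definition tm_sym (M : TM) : Type := option (bool + tm_work M).

(* The tape left of the head is listed starting from the cell next to it. *)
Record config (M : TM) : Type := Config {
  cf_state : tm_state M;
  cf_left : seq (tm_sym M);
  cf_head : tm_sym M;
  cf_right : seq (tm_sym M) }.

Definition tm_init (M : TM) (w : bits) : config M :=
  let tape := [seq Some (inl b) | b <- w] : seq (tm_sym M) in
  Config (tm_start M) [::] (head None tape) (behead tape).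

Definition tm_step (M : TM) (c : config M) : option (config M) :=
  if tm_delta (cf_state c) (cf_head c) is Some (q, a, d) then
    Some (match d with
          | MoveLeft => Config q (behead (cf_left c)) (head None (cf_left c))
                          (a :: cf_right c)
          | MoveRight => Config q (a :: cf_left c) (head None (cf_right c))
                           (behead (cf_right c))
          | Stay => Config q (cf_left c) a (cf_right c)
          end)
  else None.

Fixpoint tm_run (M : TM) (n : nat) (c : config M) : option (config M) :=
  if tm_step c is Some c' then
    (if n is m.+1 then tm_run m c' else None)
  else Some c.

Fixpoint leading_bits (A : Type) (s : seq (option (bool + A))) : bits :=
  if s is Some (inl b) :: s' then b :: leading_bits s' else [::].

(* The output is the maximal block of bits starting at the head. *)
Definition tm_output (M : TM) (c : config M) : bits :=
  leading_bits (cf_head c :: cf_right c).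

(* [Some v] if [M] on input [w] halts within [n] steps with output [v], [None]
   if it does not halt within [n] steps. *)
Definition tm_within (M : TM) (n : nat) (w : bits) : option bits :=
  omap (@tm_output M) (tm_run n (tm_init M w)).

Definition tm_value (M : TM) (w v : bits) : Prop :=
  exists n, tm_within M n w = Some v.

Definition tm_time (M : TM) (w : bits) (n : nat) : Prop :=
  tm_within M n w /\ forall m, m < n -> tm_within M m w = None.

(** ** Universal machine and its language *)

(* [lang] is the language L; [app P w] is P o w, meaningful for [P] in L and
   [w] any bit string; [nrep N] is the representation of N in L; [lstr k] is
   l_(k+1), so that the enumeration l_1, l_2, ... starts at [lstr 0]; [lidx] is
   the inverse of [lstr]. *)
Record setting : Type := Setting {
  univ : TM;
  lang : pred bits;
  app : bits -> bits -> bits;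
  nrep : nat -> bits;
  lstr : nat -> bits;
  lidx : bits -> nat }.

(* P o w_1 o ... o w_k, associating to the left: (P o w_1) is itself a program
   expecting the remaining inputs. *)
Definition apps (S : setting) (P : bits) (ws : seq bits) : bits :=
  foldl (app S) P ws.

(* [Uval S x v]: U(x) halts and U(x) = v. *)
Definition Uval (S : setting) : bits -> bits -> Prop := tm_value (univ S).

Definition has_form (S : setting) (k : nat) (x P : bits) (ws : seq bits) :=
  [/\ lang S P, size ws = k & x = apps S P ws].

Definition self_delimiting (L : pred bits) : Prop :=
  forall x y, L x -> L y -> prefix x y -> x = y.

Definition functionalizable (S : setting) : Prop :=
  [/\ forall P w, lang S P -> lang S (app S P w),
      partial_recursive 2 (fun ws v =>
        lang S (nth [::] ws 0)
        /\ v = app S (nth [::] ws 0) (nth [::] ws 1)),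
      forall k, recursive_set (fun x => exists P ws, has_form S k x P ws),
      forall k x P ws P' ws',
        has_form S k x P ws -> has_form S k x P' ws' -> P = P' /\ ws = ws'
    & forall k i, i <= k -> partial_recursive 1 (fun xs v =>
        exists P ws, has_form S k (nth [::] xs 0) P ws
                     /\ v = nth [::] (P :: ws) i)].

Definition universal (S : setting) : Prop :=
  forall k (F : seq bits -> bits -> Prop), partial_recursive k F ->
    exists2 P, lang S P &
      forall ws v, size ws = k -> Uval S (apps S P ws) v <-> F ws v.

(* [complexity S N h]: H(N) = h. *)
Definition complexity (S : setting) (N h : nat) : Prop :=
  (exists2 p, lang S p & Uval S p (nrep S N) /\ size p = h)
  /\ (forall p, lang S p -> Uval S p (nrep S N) -> h <= size p).

Definition log2 (R : realType) (x : R) : R := (ln x / ln 2)%R.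

(* The upper bound on the length concerns inputs from L: over all bit strings
   it would contradict Kraft's inequality for the prefix-free set L.  The bound
   on H is for N >= 2, where log2 (log2 N) makes sense. *)
Definition size_bounds (R : realType) (S : setting) : Prop :=
  exists (eps C' : R) (C : nat),
  [/\ (0 < eps)%R,
      forall P ws w, lang S P -> w \in ws -> size w < size (apps S P ws),
      forall P ws, lang S P -> all (lang S) ws ->
        size (apps S P ws) <= C * size ws + size P + \sum_(w <- ws) size w
    & forall N, 2 <= N -> exists2 h, complexity S N h &
        (h%:R <= C' + log2 (N%:R : R)
                 + (1 + eps) * log2 (log2 (N%:R : R)))%R].

Record universal_setting (R : realType) (S : setting) : Prop := {
  us_self_delimiting : self_delimiting (lang S);
  us_recursive : recursive_set (lang S);
  us_functionalizable : functionalizable S;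
  us_universal : universal S;
  us_size_bounds : size_bounds R S;
  us_nrep_lang : forall n, lang S (nrep S n);
  us_nrep_inj : injective (nrep S);
  us_nrep_computable : computable_seq (nrep S);
  us_lstr_computable : computable_seq (lstr S);
  us_lstrK : cancel (lstr S) (lidx S);
  us_lidxK : cancel (lidx S) (lstr S);
  us_lstr0 : lstr S 0 = [:: false] }.

(** ** Turing submachines *)

Definition total_program (S : setting) (Q : bits) : Prop :=
  forall w, lang S w -> exists t, Uval S (app S Q w) (nrep S t).

(* Index (counted from 0) in the enumeration l_1, l_2, ... of the value of the
   submachine at [w], when the time bound at [w] is [t]. *)
Definition sub_index (S : setting) (t : nat) (w : bits) : nat :=
  if tm_within (univ S) t w is Some v then (lidx S v).+1 else 0.

(* [sub_value S Q w v]: U_Q(w) = v. *)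
Definition sub_value (S : setting) (Q w v : bits) : Prop :=
  exists2 t, Uval S (app S Q w) (nrep S t) & v = lstr S (sub_index S t w).

(* The time bound is total, and U_Q is a machine (it is computed by a program
   [M] run on U) that halts on all of L. *)
Definition turing_submachine (S : setting) (Q : bits) : Prop :=
  [/\ total_program S Q,
      forall w, lang S w -> exists! v, sub_value S Q w v
    & exists2 M, lang S M &
        forall w v, lang S w -> Uval S (app S M w) v <-> sub_value S Q w v].

(** ** The programs *)

(* A bit string b_1 ... b_n read as the binary real 0.b_1 ... b_n. *)
Definition binval (s : bits) : rat :=
  (\sum_(i < size s) (nth false s i)%:R / 2 ^+ i.+1)%R.

Definition time_bounds (S : setting) (Q : bits) (n : nat) (tau : bits -> nat) :=
  forall p, lang S p -> size p <= n -> Uval S (app S Q p) (nrep S (tau p)).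

(* Sum of 2^-|p| over the programs p with |p| <= n halting within tau(p)
   steps. *)
Definition halting_sum (S : setting) (tau : bits -> nat) (n : nat) : rat :=
  (\sum_(m < n.+1)
     \sum_(p : m.-tuple bool | lang S p && tm_within (univ S) (tau p) p)
        2 ^- m)%R.

Definition max_sub_index (S : setting) (tau : bits -> nat) (n : nat) : nat :=
  \max_(m < n.+1) \max_(p : m.-tuple bool | lang S p) sub_index S (tau p) p.

Definition is_T (S : setting) (T : bits) : Prop :=
  forall p v, lang S p ->
    Uval S (app S T p) v <-> (exists2 t, tm_time (univ S) p t & v = nrep S t).

(* The program runs Q on every program of size at most N, so it is undefined as
   soon as one of these finitely many time bounds is. *)
Definition is_Psum (S : setting) (Psum : bits) : Prop :=
  forall Q N (s : rat), lang S Q ->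
    (exists2 v, Uval S (apps S Psum [:: Q; nrep S N]) v & binval v = s) <->
    (if N is 0 then s = 0%R
     else exists2 tau, time_bounds S Q N tau & s = halting_sum S tau N).

Definition unary (rho : bits) : bits := rcons (nseq (size rho) false) true.

(* pi' o Q o 0^|rho| 1 o rho *)
Definition Omega_prog (S : setting) (piO Q rho : bits) : bits :=
  apps S piO [:: Q; unary rho; rho].

(* Outputs of U_Q are compared, and incremented, along the enumeration
   l_1 = 0, l_2, ...; the loop looks at Q only on programs of size <= k. *)
Definition is_piOmega (S : setting) (piO : bits) : Prop :=
  forall Q rho v, lang S Q ->
    Uval S (Omega_prog S piO Q rho) v <->
    (binval rho = 0%R /\ v = lstr S 0)
    \/ (binval rho <> 0%R /\
        exists k tau,
          [/\ 0 < k, time_bounds S Q k tau,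
              (binval rho <= halting_sum S tau k)%R,
              forall j, 0 < j < k -> (halting_sum S tau j < binval rho)%R
            & v = lstr S (max_sub_index S tau k).+1]).

(* Conditions are evaluated from left to right, each evaluation possibly
   diverging: the form of [w], the sum, then the comparison of the times. *)
Definition is_Pstar (S : setting) (T Psum piO Pstar : bits) : Prop :=
  forall Q PT w v, lang S Q -> lang S PT -> lang S w ->
    Uval S (apps S Pstar [:: Q; PT; w]) v <->
    ((~ exists rho, w = Omega_prog S piO Q rho) /\ Uval S (app S PT w) v)
    \/ (exists rho r,
          [/\ w = Omega_prog S piO Q rho,
              Uval S (apps S Psum [:: Q; nrep S (size w).-1]) r
            & ((binval r < binval rho)%R /\ Uval S (app S PT w) v)
              \/ ((binval rho <= binval r)%R /\
                  exists t t',
                    [/\ Uval S (app S T w) (nrep S t),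
                        Uval S (app S PT w) (nrep S t')
                      & v = nrep S (if t' < t then t else t')])]).

(* The first input of P* is the program P** o P_T. *)
Definition is_Pstar2 (S : setting) (Pstar Pstar2 : bits) : Prop :=
  forall PT w v, lang S PT -> lang S w ->
    Uval S (apps S Pstar2 [:: PT; w]) v <->
    Uval S (apps S Pstar [:: apps S Pstar2 [:: PT]; PT; w]) v.

(* Main.v *)
Require Import Defs.
From mathcomp Require Import all_boot all_order all_algebra.
From mathcomp Require Import reals.
From mathcomp Require Import boolp zify.

(* Write Q for P** o P_T.  Totality of Q is proved by strong induction on |w|.
   The only case where Q does not merely run P_T is w = pi' o Q o 0^|rho|1 o rho;
   then P_sum consults Q on programs shorter than w only, which halts by
   induction, and if its value is at least rho, the search performed by w itself
   stops at some k < |w|, so that w halts and T measures its running time.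

   That U_Q is itself computed by a program follows from the totality of Q and
   universality, once the runs of a Turing machine are arithmetized: halves of
   the tape become numerals, a configuration becomes one number, and one step is
   a table lookup followed by multiplications and divisions by the base. *)

Set Implicit Arguments.
Unset Strict Implicit.
Unset Printing Implicit Defensive.

(** * Computable functions on lists of numbers *)

Definition computes (f : recfun) (xs : seq nat) (z : nat) : Prop :=
  forall y, rsem f xs y <-> y = z.

(** The domain lets a function be computable just where it is specified, such as a time bound on
    codes of programs in L; outside [D] the term is unconstrained. *)
Definition computable_on (D : seq nat -> Prop) (F : seq nat -> nat) : Prop :=
  exists f, forall xs, D xs -> computes f xs (F xs).

Definition computable1 (g : nat -> nat) :=
  computable_on (fun xs => size xs = 1) (fun xs => g (nth 0 xs 0)).
Definition computable2 (g : nat -> nat -> nat) :=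
  computable_on (fun xs => size xs = 2) (fun xs => g (nth 0 xs 0) (nth 0 xs 1)).
Definition computable3 (g : nat -> nat -> nat -> nat) :=
  computable_on (fun xs => size xs = 3)
    (fun xs => g (nth 0 xs 0) (nth 0 xs 1) (nth 0 xs 2)).

Implicit Types (D : seq nat -> Prop) (X Y Z N : seq nat -> nat).

Lemma computable_on_ext D X Y :
  (forall xs, D xs -> X xs = Y xs) -> computable_on D X -> computable_on D Y.
Proof. by move=> XY [f hf]; exists f => xs Dxs; rewrite -XY //; apply: hf. Qed.

Lemma computable_nth D i : computable_on D (fun xs => nth 0 xs i).
Proof. by exists (RProj i). Qed.

Lemma computable_comp1 D g X :
  computable1 g -> computable_on D X -> computable_on D (fun xs => g (X xs)).
Proof.
move=> [f hf] [f1 h1]; exists (RComp f [:: f1]) => xs Dxs y /=; split.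
  case=> -[|x [|? ?]] //=; last by case.
  by case=> /h1-> // _ /hf-> //.
move=> ->; exists [:: X xs]; first by split=> //; apply/h1.
exact/hf.
Qed.

Lemma computable_comp2 D g X Y :
  computable2 g -> computable_on D X -> computable_on D Y ->
  computable_on D (fun xs => g (X xs) (Y xs)).
Proof.
move=> [f hf] [f1 h1] [f2 h2]; exists (RComp f [:: f1; f2]) => xs Dxs y /=.
split.
  case=> -[|x1 [|x2 [|? ?]]] //=; try by [case|case=> _ []].
  by case=> /h1-> // [/h2-> // _] /hf-> //.
move=> ->; exists [:: X xs; Y xs].
  by split; [apply/h1|split=> //; apply/h2].
exact/hf.
Qed.

Lemma computable_comp3 D g X Y Z :
  computable3 g -> computable_on D X -> computable_on D Y ->
  computable_on D Z -> computable_on D (fun xs => g (X xs) (Y xs) (Z xs)).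
Proof.
move=> [f hf] [f1 h1] [f2 h2] [f3 h3].
exists (RComp f [:: f1; f2; f3]) => xs Dxs y /=; split.
  case=> -[|x1 [|x2 [|x3 [|? ?]]]] //=; try by [case|case=> _ []|case=> _ [_ []]].
  by case=> /h1-> // [/h2-> // [/h3-> // _]] /hf-> //.
move=> ->; exists [:: X xs; Y xs; Z xs].
  by split; [apply/h1|split; [apply/h2|split=> //; apply/h3]].
exact/hf.
Qed.

Lemma computable_succ D X :
  computable_on D X -> computable_on D (fun xs => (X xs).+1).
Proof. by apply: (computable_comp1 (g := succn)); exists RSucc => -[|x []]. Qed.

Lemma computable_const D c : computable_on D (fun=> c).
Proof. by elim: c => [|c IHc]; [exists RZero | apply: computable_succ]. Qed.

Lemma computable2_prec g h :
  computable1 g -> computable3 h ->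
  computable2 (fun n x => nat_rect _ (g x) (fun m z => h m z x) n).
Proof.
move=> [f hf] [f' hf']; exists (RPrec f f') => -[|n [|x []]] //= _.
elim: n => [|n IHn] y /=; first exact: hf.
split=> [[z /IHn-> /hf' ->]//|->].
by eexists; [apply/IHn | apply/hf'].
Qed.

Lemma computable_iter D g N X :
  computable1 g -> computable_on D N -> computable_on D X ->
  computable_on D (fun xs => iter (N xs) g (X xs)).
Proof.
move=> hg; apply: (computable_comp2 (g := fun n x => iter n g x)).
have := @computable2_prec id (fun _ z _ => g z) (computable_nth _ 0)
  (computable_comp1 hg (computable_nth _ 1)).
by apply: computable_on_ext => xs _; elim: (nth 0 xs 0) => //= n ->.
Qed.

Lemma computable_ifz D X Y Z :
  computable_on D X -> computable_on D Y -> computable_on D Z ->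
  computable_on D (fun xs => if X xs == 0 then Y xs else Z xs).
Proof.
apply: (computable_comp3 (g := fun x y z => if x == 0 then y else z)).
(* The recursion ignores its accumulator: the base sees [x, y] and returns entry 0; the step sees
   [m, z, x, y] and returns entry 3. *)
exists (RPrec (RProj 0) (RProj 3)) => -[|c [|x [|y []]]] //= _.
elim: c => [|c IHc] v //=; split=> [[]//|->].
by eexists; [apply/IHc|].
Qed.

Lemma computable_add D X Y :
  computable_on D X -> computable_on D Y -> computable_on D (fun xs => X xs + Y xs).
Proof.
move=> hX hY.
have hS : computable1 succn by apply: computable_succ; apply: computable_nth.
have := computable_iter hS hX hY; apply: computable_on_ext => xs _.
by elim: (X xs) => //= n ->.
Qed.

Lemma computable_pred D X :
  computable_on D X -> computable_on D (fun xs => (X xs).-1).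
Proof.
apply: (computable_comp1 (g := predn)).
(* The recursion step sees its index [m] first and returns it, so the value at [m.+1] is [m]. *)
exists (RComp (RPrec RZero (RProj 0)) [:: RProj 0; RZero]) => -[|x []] //= _ y.
split.
  case=> -[|x1 [|x2 [|? ?]]] //=; try by [case|case=> _ []].
  by case=> -> [_ _]; case: x => //= n [].
move=> ->; exists [:: x; 0] => //=.
elim: x => //= n IHn; eexists; [exact: IHn|by []].
Qed.

Lemma computable_sub D X Y :
  computable_on D X -> computable_on D Y -> computable_on D (fun xs => X xs - Y xs).
Proof.
move=> hX hY.
have hP : computable1 predn by apply: computable_pred; apply: computable_nth.
have := computable_iter hP hY hX; apply: computable_on_ext => xs _.
by elim: (Y xs) => [|n IHn] /=; lia.
Qed.

Lemma computable_mul D X Y :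
  computable_on D X -> computable_on D Y -> computable_on D (fun xs => X xs * Y xs).
Proof.
apply: computable_comp2.
have := @computable2_prec (fun=> 0) (fun _ z x => x + z) (computable_const _ 0)
  (computable_add (computable_nth _ 2) (computable_nth _ 1)).
by apply: computable_on_ext => xs _; elim: (nth 0 xs 0) => //= n ->; rewrite mulSn.
Qed.

(** All inversions go through this lemma: quotients, square roots, halting times and inverses of
    enumerations are least zeros of a computable function. *)
Lemma computable_mu D g X Y :
  computable2 g -> computable_on D X ->
  (forall xs, D xs ->
     g (Y xs) (X xs) = 0 /\ forall m, m < Y xs -> 0 < g m (X xs)) ->
  computable_on D Y.
Proof.
move=> [f hf] [f1 h1] gY; exists (RComp (RMu f) [:: f1]) => xs Dxs y.
have {gY} [gY0 gYm] := gY _ Dxs.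
have hg a b : rsem f [:: a; X xs] b <-> b = g a (X xs) by apply: hf.
split=> /= [[[|x [|? ?]] //=]|->]; try by case.
- case=> /h1-> // _ [/hg gy0 gym]; case: (ltngtP y (Y xs)) => // [/gYm|/gym[z /hg]].
    by rewrite -gy0.
  by rewrite gY0.
- exists [:: X xs]; first by split=> //; apply/h1.
  split; first by apply/hg; rewrite gY0.
  by move=> m /gYm; exists (g m (X xs)).-1; apply/hg; rewrite prednK.
Qed.

Lemma computable_divn D (d : nat) X :
  0 < d -> computable_on D X -> computable_on D (fun xs => X xs %/ d).
Proof.
(* The truncated difference vanishes exactly when [x < m.+1 * d], and the quotient is the least such
   [m]. *)
move=> d_gt0 hX; apply: (@computable_mu D (fun m x => x.+1 - m.+1 * d) X) => //.
  apply: computable_sub; first by apply: computable_succ; apply: computable_nth.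
  apply: computable_mul; last exact: computable_const.
  by apply: computable_succ; apply: computable_nth.
move=> xs _; split=> [|m]; first by have := ltn_ceil (X xs) d_gt0; lia.
by rewrite leq_divRL // subn_gt0 ltnS.
Qed.

Lemma computable_modn D (d : nat) X :
  0 < d -> computable_on D X -> computable_on D (fun xs => X xs %% d).
Proof.
move=> d_gt0 hX.
have : computable_on D (fun xs => X xs - X xs %/ d * d).
  apply: computable_sub => //; apply: computable_mul; last exact: computable_const.
  exact: computable_divn.
by apply: computable_on_ext => xs _; rewrite {1}(divn_eq (X xs) d) addKn.
Qed.

(** * Integer square root, pairing and finite tables *)

Definition sqrtn (x : nat) : nat :=
  ex_minn (ex_intro (fun m => x < m.+1 * m.+1) x (leq_pmulr x.+1 (ltn0Sn x))).

(** This number is at least the square of [a + b] and below that of [a + b + 1], so the integer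
    square root recovers [a + b], and the remainder is [a]. *)
Definition pairn (a b : nat) : nat := (a + b) * (a + b) + a.
Definition fstn (x : nat) : nat := x - sqrtn x * sqrtn x.
Definition sndn (x : nat) : nat := sqrtn x - fstn x.

Lemma sqrtn_pairn a b : sqrtn (pairn a b) = a + b.
Proof.
rewrite /sqrtn; case: ex_minnP => m; rewrite /pairn => lt_m min_m.
apply/eqP; rewrite eqn_leq min_m; last by nia.
by rewrite leqNgt; apply/negP; nia.
Qed.

Lemma fstn_pairn a b : fstn (pairn a b) = a.
Proof. by rewrite /fstn sqrtn_pairn /pairn addKn. Qed.

Lemma sndn_pairn a b : sndn (pairn a b) = b.
Proof. by rewrite /sndn fstn_pairn sqrtn_pairn addKn. Qed.

Definition pairnK := (fstn_pairn, sndn_pairn).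

Lemma computable_sqrtn D X :
  computable_on D X -> computable_on D (fun xs => sqrtn (X xs)).
Proof.
move=> hX; apply: (@computable_mu D (fun m x => x.+1 - m.+1 * m.+1) X) => //.
  by apply: computable_sub; [|apply: computable_mul]; apply: computable_succ;
    apply: computable_nth.
move=> xs _; rewrite /sqrtn; case: ex_minnP => m lt_m min_m.
split=> [|n lt_nm]; first by lia.
by rewrite subn_gt0 ltnS leqNgt; apply: contraL lt_nm => /min_m; rewrite leqNgt.
Qed.

Lemma computable_pairn D X Y :
  computable_on D X -> computable_on D Y ->
  computable_on D (fun xs => pairn (X xs) (Y xs)).
Proof.
move=> hX hY; apply: computable_add => //.
by apply: computable_mul; apply: computable_add.
Qed.

Lemma computable_fstn D X :
  computable_on D X -> computable_on D (fun xs => fstn (X xs)).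
Proof.
move=> hX; apply: computable_sub => //.
by apply: computable_mul; apply: computable_sqrtn.
Qed.

Lemma computable_sndn D X :
  computable_on D X -> computable_on D (fun xs => sndn (X xs)).
Proof.
move=> hX; apply: computable_sub; first exact: computable_sqrtn.
exact: computable_fstn.
Qed.

(** A finite function is a lookup in a fixed list, itself a nested case analysis; transition tables
    of machines are treated this way. *)
Lemma computable_table (A : finType) (code val : A -> nat) :
  injective code ->
  exists2 g, computable1 g & forall a, g (code a) = val a.
Proof.
move=> code_inj.
pose f i := if [pick a | code a == i] is Some a then val a else 0.
have fE a : f (code a) = val a.
  rewrite /f; case: pickP => [b /eqP/code_inj->//|/(_ a)].
  by rewrite eqxx.
have nth_computable s D X :
    computable_on D X -> computable_on D (fun xs => nth 0 s (X xs)).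
  elim: s X => [|c s IHs] X hX.
    apply: computable_on_ext (computable_const D 0) => xs _.
    by rewrite nth_nil.
  have := computable_ifz hX (computable_const D c) (IHs _ (computable_pred hX)).
  by apply: computable_on_ext => xs _; case: (X xs).
exists (nth 0 (mkseq f (\max_a code a).+1)).
  exact: nth_computable (computable_nth _ 0).
by move=> a; rewrite nth_mkseq ?fE // ltnS leq_bigmax.
Qed.

Ltac computability :=
  cbv beta zeta delta [computable1 computable2];
  repeat first
    [ assumption
    | match goal with
      | |- computable_on _ (fun _ => nth 0 _ _) => apply: computable_nth
      | |- computable_on _ (fun=> _) => apply: computable_const
      | |- computable_on _ (fun _ => if _ == 0 then _ else _) =>
          apply: computable_ifz
      | |- computable_on _ (fun _ => pairn _ _) => apply: computable_pairn
      | |- computable_on _ (fun _ => fstn _) => apply: computable_fstn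
      | |- computable_on _ (fun _ => sndn _) => apply: computable_sndn
      | |- computable_on _ (fun _ => _ %/ _) => apply: computable_divn => //
      | |- computable_on _ (fun _ => _ %% _) => apply: computable_modn => //
      | |- computable_on _ (fun _ => _.-1) => apply: computable_pred
      | |- computable_on _ (fun _ => _ + _) => apply: computable_add
      | |- computable_on _ (fun _ => _ - _) => apply: computable_sub
      | |- computable_on _ (fun _ => _ * _) => apply: computable_mul
      | |- computable_on _ (fun _ => iter _ _ _) => apply: computable_iter
      | H : computable1 ?g |- computable_on _ (fun _ => ?g _) =>
          apply: (computable_comp1 H)
      | H : computable2 ?g |- computable_on _ (fun _ => ?g _ _) =>
          apply: (computable_comp2 H)
      | |- computable_on _ (fun _ => _.+1) => apply: computable_succ
      (* Last resort, for composites such as [bcode (nrep S m)], which have to be recognized by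
         unification. *)
      | H : computable1 _ |- _ => apply: (computable_comp1 H)
      end ].

(** * Bit strings as numerals *)

(** The digits are 1 and 2, so that a digit 0 can mark the end of the string. *)
Fixpoint numeral (b : nat) (s : bits) : nat :=
  if s is x :: s' then x.+1 + b * numeral b s' else 0.

Lemma bcode_numeral s : bcode s = numeral 2 s.
Proof. by elim: s => //= b s <-; lia. Qed.

Lemma size_bcode s : size s <= bcode s.
Proof. by elim: s => //= b s IHs; lia. Qed.

Lemma bcode_inj : injective bcode.
Proof.
elim=> [|b s IHs] [|b' s'] //=; try by lia.
move=> e; have eb : b = b' by case: b b' e => [] [] // e; lia.
by rewrite eb (IHs s') //; move: e; rewrite eb; lia.
Qed.

Lemma bcode_surj n : exists s, bcode s = n.
Proof.
elim/ltn_ind: n => -[_|n IHn]; first by exists [::].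
have [s es] : exists s, bcode s = n./2 by apply: IHn; lia.
by exists (odd n :: s) => /=; rewrite es; lia.
Qed.

(* The digits [b.+1] of [s] are read off [x] in order, and accumulated in base
   [b0] by iterating on triples (value, power of [b0], remaining input). *)
Lemma computable_transcode (b0 : nat) (dig nxt : nat -> nat)
    (repr : nat -> bits -> Prop) :
  computable1 dig -> computable1 nxt ->
  (forall x, repr x [::] -> dig x = 0) ->
  (forall x b s, repr x (b :: s) -> dig x = b.+1 /\ repr (nxt x) s) ->
  (forall x s, repr x s -> size s <= x) ->
  exists2 g, computable1 g & forall x s, repr x s -> g x = numeral b0 s.
Proof.
move=> hdig hnxt repr0 reprS repr_size.
pose st v p x := pairn v (pairn p x).
pose step c := let v := fstn c in let p := fstn (sndn c) in
  let x := sndn (sndn c) in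
  if dig x == 0 then c else st (v + p * dig x) (b0 * p) (nxt x).
(* The input bounds the number of its digits, so [x] rounds suffice; once the digit read is 0,
   further rounds change nothing. *)
exists (fun x => fstn (iter x step (st 0 1 x))).
  have hstep : computable1 step by rewrite /step /st; computability.
  by rewrite /st; computability.
have stepE v p x : step (st v p x)
    = if dig x == 0 then st v p x else st (v + p * dig x) (b0 * p) (nxt x).
  by rewrite /step /st !pairnK.
suff main n s v p x : repr x s -> size s <= n ->
    fstn (iter n step (st v p x)) = v + p * numeral b0 s.
  by move=> x s xs; rewrite (main _ s) ?repr_size // mul1n.
elim: n s v p x => [|n IHn] [|b s] v p x xs //=.
- by rewrite /st pairnK muln0 addn0.
- move=> _; rewrite -iterS; suff -> : iter n.+1 step (st v p x) = st v p x.
    by rewrite /st pairnK muln0 addn0.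
  by apply: iter_fix; rewrite stepE repr0.
- rewrite ltnS => sn; have [dE xs'] := reprS _ _ _ xs.
  by rewrite -iterS iterSr stepE dE /= (IHn _ _ _ _ xs' sn); lia.
Qed.

(** * Arithmetization of Turing machines *)

Section Simulation.

Variable M : TM.

(** One digit for the blank, two for the bits, one per work symbol. *)
Local Notation B := #|tm_work M|.+3.

(* The blank is 0, so that the infinitely many blanks at the end of a tape do
   not change its numeral; the bit [b] is [b.+1], as in [numeral]. *)
Definition symcode (a : tm_sym M) : nat :=
  match a with
  | None => 0
  | Some (inl b) => b.+1
  | Some (inr c) => enum_rank c + 3
  end.

Fixpoint tapecode (t : seq (tm_sym M)) : nat :=
  if t is a :: t' then symcode a + B * tapecode t' else 0.

Definition statecode (q : tm_state M) : nat := enum_rank q.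

(** The scanned cell is the lowest digit of the right half, so it is found by reduction modulo the
    base, and the output is read off the same numeral. *)
Definition confcode (c : config M) : nat :=
  pairn (statecode (cf_state c))
    (pairn (tapecode (cf_left c)) (tapecode (cf_head c :: cf_right c))).

Lemma symcode_lt a : symcode a < B.
Proof. by case: a => [[[]|c]|] //=; rewrite addn3 !ltnS. Qed.

Lemma symcode_inj : injective symcode.
Proof.
case=> [[b|c]|] [[b'|c']|] //=; try by (try case: b); (try case: b'); lia.
  by case: b b' => [] [].
by move=> /addIn/ord_inj/enum_rank_inj->.
Qed.

Lemma tapecode_mod t : tapecode t %% B = symcode (head None t).
Proof.
case: t => [|a t]; first by rewrite mod0n.
by rewrite /= mulnC addnC modnMDl modn_small ?symcode_lt.
Qed.

Lemma tapecode_div t : tapecode t %/ B = tapecode (behead t).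
Proof.
case: t => [|a t]; first by rewrite div0n.
by rewrite /= mulnC addnC divnMDl // divn_small ?symcode_lt // addn0.
Qed.

(** Past the end of a tape the head reads a default blank, whose digit 0 leaves the numeral
    unchanged. *)
Lemma tapecode_head_behead t : tapecode (head None t :: behead t) = tapecode t.
Proof. by case: t => //=; rewrite muln0. Qed.

Definition keycode (k : tm_state M * tm_sym M) : nat :=
  pairn (statecode k.1) (symcode k.2).

Lemma keycode_inj : injective keycode.
Proof.
move=> [q a] [q' a'] /= e.
have := congr1 fstn e; have := congr1 sndn e; rewrite !pairnK /=.
by move=> /symcode_inj-> /ord_inj/enum_rank_inj->.
Qed.

(** Halting configurations become fixed points, so that a run is an iteration of a total
    function. *)
Definition tm_next (c : config M) : config M := odflt c (tm_step c).

Lemma tm_runE n c :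
  tm_run n c = let c' := iter n tm_next c in
               if tm_step c' is None then Some c' else None.
Proof.
elim: n c => [|n IHn] c; first by rewrite /=; case: (tm_step c).
rewrite iterSr [tm_run _ _]/= [tm_next c]/tm_next.
case E: (tm_step c) => [c'|] /=.
  by rewrite IHn.
by rewrite iter_fix ?E // /tm_next E.
Qed.

Lemma computable_step :
  exists2 halts, computable1 halts & exists2 next, computable1 next &
    forall c, (halts (confcode c) == 0) = ~~ tm_step c
              /\ next (confcode c) = confcode (tm_next c).
Proof.
(* Code 0 is reserved for the absence of a transition, so this table also decides halting. *)
pose dir (k : tm_state M * tm_sym M) := if tm_delta k.1 k.2 is Some (_, _, d)
  then match d with MoveLeft => 1 | MoveRight => 2 | Stay => 3 end else 0.
pose newq k := if tm_delta k.1 k.2 is Some (q, _, _) then statecode q else 0.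
pose newa k := if tm_delta k.1 k.2 is Some (_, a, _) then symcode a else 0.
have [gd hgd gdE] := computable_table dir keycode_inj.
have [gq hgq gqE] := computable_table newq keycode_inj.
have [ga hga gaE] := computable_table newa keycode_inj.
pose key c := pairn (fstn c) (sndn (sndn c) %% B).
pose L c := fstn (sndn c).
pose rest c := sndn (sndn c) %/ B.
pose goleft c := pairn (gq (key c))
  (pairn (L c %/ B) (L c %% B + B * (ga (key c) + B * rest c))).
pose goright c := pairn (gq (key c)) (pairn (ga (key c) + B * L c) (rest c)).
pose stay c := pairn (gq (key c)) (pairn (L c) (ga (key c) + B * rest c)).
exists (fun c => gd (key c)); first by rewrite /key; computability.
exists (fun c => if gd (key c) == 0 then c else if gd (key c) - 1 == 0
    then goleft c else if gd (key c) - 2 == 0 then goright c else stay c).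
  by rewrite /goleft /goright /stay /L /rest /key; computability.
case=> q l a r.
have keyE : key (confcode (Config q l a r)) = keycode (q, a).
  by rewrite /key /confcode !pairnK tapecode_mod.
have LE : L (confcode (Config q l a r)) = tapecode l by rewrite /L !pairnK.
have restE : rest (confcode (Config q l a r)) = tapecode r.
  by rewrite /rest !pairnK tapecode_div.
rewrite /goleft /goright /stay keyE LE restE gdE gqE gaE.
rewrite /dir /newq /newa /tm_next /tm_step /=.
case: (tm_delta q a) => [[[q' a'] []]|] //=; split=> //.
- by rewrite tapecode_mod tapecode_div.
- by congr (pairn _ (pairn _ _)); apply: esym; apply: tapecode_head_behead.
Qed.

(* The value is shifted by one, 0 meaning that the machine is still running. *)
Lemma computable_tm_within :
  exists2 W, computable2 W & forall n w,
    W n (bcode w) = if tm_within M n w is Some v then (bcode v).+1 else 0.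
Proof.
have [halts hhalts [next hnext stepE]] := computable_step.
have [enc henc encE] : exists2 g, computable1 g &
    forall x s, x = bcode s -> g x = numeral B s.
  (* A nonzero [x] is [d + 2 * q] with [d] equal to 1 or 2, so [q] is [x.-1 %/ 2]; for [x = 0] the
     digit is 0. *)
  apply: (@computable_transcode B (fun x => x - x.-1 %/ 2 * 2)
    (fun x => x.-1 %/ 2)); try by computability.
  - by move=> x ->.
  - by move=> x b s -> /=; split; case: b; lia.
  - by move=> x s ->; apply: size_bcode.
have [out hout outE] : exists2 g, computable1 g & forall x s,
    (exists2 t, x = tapecode t & s = leading_bits t) -> g x = numeral 2 s.
  (* Digits above 2 are work symbols; they are replaced by 0, so that reading stops at the first
     cell that is not a bit. *)
  apply: (@computable_transcode 2
    (fun x => if x %% B - 2 == 0 then x %% B else 0) (fun x => x %/ B));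
    try by computability.
  - move=> x [t -> e]; rewrite tapecode_mod.
    by case: t e => [|[[b|c]|] t] //= _; rewrite addn3.
  - move=> x b s [[|[[b'|c]|] t] -> //= [-> ->]].
    rewrite -[_ + _]/(tapecode (Some (inl b') :: t)) tapecode_mod tapecode_div.
    by split; [case: b' | exists t].
  - move=> x s [t -> ->]; elim: t => [|[[b|c]|] t IHt] //=; nia.
have initE w : confcode (tm_init M w)
    = pairn (statecode (tm_start M)) (pairn 0 (numeral B w)).
  rewrite /confcode tapecode_head_behead /=; congr (pairn _ (pairn _ _)).
  by elim: w => //= b w ->.
pose st n x := iter n next (pairn (statecode (tm_start M)) (pairn 0 (enc x))).
exists (fun n x => if halts (st n x) == 0
                   then (out (sndn (sndn (st n x)))).+1 else 0).
  by rewrite /st; computability.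
move=> n w; rewrite /tm_within tm_runE /st (encE _ w) // -initE.
have -> : iter n next (confcode (tm_init M w))
    = confcode (iter n tm_next (tm_init M w)).
  by elim: n => //= n ->; case: (stepE (iter n tm_next (tm_init M w))).
have [-> _] := stepE (iter n tm_next (tm_init M w)) => /=.
case: (tm_step _) => //=; rewrite /confcode !pairnK bcode_numeral.
by congr _.+1; apply: outE; eexists.
Qed.

(** * Monotonicity and determinism of runs *)

Lemma tm_within_mono m n w v :
  m <= n -> tm_within M m w = Some v -> tm_within M n w = Some v.
Proof.
rewrite /tm_within !tm_runE /= => /subnKC <-; rewrite addnC iterD.
case E: (tm_step (iter m _ _)) => //= [] [<-].
by rewrite iter_fix ?E // /tm_next E.
Qed.

Lemma tm_value_fun w v v' : tm_value M w v -> tm_value M w v' -> v = v'.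
Proof.
move=> [m mv] [n nv'].
have := tm_within_mono (leq_maxl m n) mv.
by rewrite (tm_within_mono (leq_maxr m n) nv') => -[].
Qed.

Lemma tm_value_time w v : tm_value M w v -> exists t, tm_time M w t.
Proof.
move=> [n nv].
have ex : exists n, isSome (tm_within M n w) by exists n; rewrite nv.
case: (ex_minnP ex) => t ht mint; exists t; split=> // m lt_mt.
case E: (tm_within M m w) => [u|//].
by have := mint m; rewrite E leqNgt lt_mt => /(_ isT).
Qed.

End Simulation.

(** * Turing submachines *)

Section Submachine.

Variables (R : realType) (S : setting) (hS : universal_setting R S).

Lemma Uval_fun x v v' : Uval S x v -> Uval S x v' -> v = v'.
Proof. exact: tm_value_fun. Qed.

Lemma computable_seq1 u : computable_seq u -> computable1 (fun n => bcode (u n)).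
Proof. by move=> [f hf]; exists f => -[|n []] //= _ y; apply: hf. Qed.

(** The halting time of U on [app S Q w] is found by a search, which ends because [Q] is total. The
    output is turned into a time bound by searching for the number it represents, and [w] is then
    run for that many steps. *)
Lemma computable_submachine Q : lang S Q -> total_program S Q ->
  exists f, forall w, lang S w -> forall v,
    rsem f [:: bcode w] (bcode v) <-> sub_value S Q w v.
Proof.
move=> Q_lang Q_total.
have [dec decK] := choice bcode_surj.
have bcodeK : cancel bcode dec by move=> s; apply: bcode_inj; rewrite decK.
have [w|tau tauP] :=
    @choice _ _ (fun w t => lang S w -> Uval S (app S Q w) (nrep S t)).
  by case: (boolP (lang S w)) => [/Q_total[t]|_]; [exists t | exists 0].
have [w|stp stpP] :=
    @choice _ _ (fun w t => lang S w -> tm_time (univ S) (app S Q w) t).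
  case: (boolP (lang S w)) => [/tauP/tm_value_time[t]|_]; last by exists 0.
  by exists t.
pose D xs := exists2 w, lang S w & xs = [:: bcode w].
pose arg (xs : seq nat) := dec (nth 0 xs 0).
have [W hW WE] := computable_tm_within (univ S).
have hnrep := computable_seq1 (us_nrep_computable hS).
have hlstr := computable_seq1 (us_lstr_computable hS).
(* [app] is only partial recursive, but it is defined whenever its first argument is in L, as the
   constant [Q] is. *)
have happ : computable_on D (fun xs => bcode (app S Q (arg xs))).
  have [_ [f hf] _ _ _] := us_functionalizable hS.
  have [fQ hfQ] : computable_on D (fun=> bcode Q) by apply: computable_const.
  exists (RComp f [:: fQ; RProj 0]) => _ [w w_lang ->] y; rewrite /arg /= bcodeK.
  have Dw : D [:: bcode w] by exists w.
  have fE z : rsem f [:: bcode Q; bcode w] z <-> z = bcode (app S Q w).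
    by rewrite (hf [:: Q; w] z erefl); split=> [[_ [_ ->]]|->]; last eexists.
  split=> [[[|x [|x' [|? ?]]] //=]|->]; try by [case|case=> _ []].
    by case=> /hfQ-> // [-> _] /fE.
  by exists [:: bcode Q; bcode w]; [split=> //; apply/hfQ | apply/fE].
have hstp : computable_on D (fun xs => stp (arg xs)).
  (* [1 - W n x] vanishes exactly when the run is over within [n] steps. *)
  apply: (@computable_mu D (fun n x => 1 - W n x) _ _ _ happ).
    by computability.
  move=> _ [w w_lang ->]; rewrite /arg /= bcodeK WE.
  have [h1 h2] := stpP w w_lang; split; first by case: (tm_within _ _ _) h1.
  by move=> m /h2 e; rewrite WE e.
have htime : computable_on D (fun xs => bcode (nrep S (tau (arg xs)))).
  have : computable_on D
      (fun xs => (W (stp (arg xs)) (bcode (app S Q (arg xs)))).-1).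
    by computability.
  apply: computable_on_ext => _ [w w_lang ->]; rewrite /arg /= bcodeK WE.
  have [h1 _] := stpP w w_lang; case E: (tm_within _ _ _) h1 => [v|//] _.
  by congr bcode; apply: Uval_fun (tauP _ w_lang); exists (stp w).
have htau : computable_on D (fun xs => tau (arg xs)).
  (* The sum of the two truncated differences is a distance, zero only at equality; injectivity of
     [nrep] makes the zero unique. The same device inverts [lstr] below. *)
  apply: (@computable_mu D (fun m x =>
    (bcode (nrep S m) - x) + (x - bcode (nrep S m))) _ _ _ htime).
    by computability.
  move=> _ [w w_lang ->]; rewrite /arg /= bcodeK; split=> [|m]; first by lia.
  case: (eqVneq (bcode (nrep S m)) (bcode (nrep S (tau w)))); last by lia.
  by move=> /bcode_inj/(us_nrep_inj hS)->; rewrite ltnn.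
have hlidx : computable1 (fun x => lidx S (dec x)).
  apply: (@computable_mu _ (fun m x =>
    (bcode (lstr S m) - x) + (x - bcode (lstr S m))) _ _ _ (computable_nth _ 0)).
    by computability.
  move=> xs _; rewrite (us_lidxK hS) decK; split=> [|m]; first by lia.
  case: (eqVneq (bcode (lstr S m)) (nth 0 xs 0)); last by lia.
  by move=> <-; rewrite bcodeK (us_lstrK hS) ltnn.
have hsub : computable_on D (fun xs => sub_index S (tau (arg xs)) (arg xs)).
  pose V xs := W (tau (arg xs)) (nth 0 xs 0).
  have hV : computable_on D V by rewrite /V; computability.
  have : computable_on D
      (* A run cut off by the time bound has value 0 and gets index 0, that of l_1; otherwise the
         shift in [W] is undone before decoding. *)
      (fun xs => if V xs == 0 then 0 else (lidx S (dec (V xs).-1)).+1).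
    apply: computable_ifz => //; first exact: computable_const.
    by apply: computable_succ; apply: (computable_comp1 hlidx); apply: computable_pred.
  apply: computable_on_ext => _ [w w_lang ->]; rewrite /V /arg /= bcodeK WE.
  by rewrite /sub_index; case: (tm_within _ _ _) => //= v; rewrite bcodeK.
have [f hf] := computable_comp1 hlstr hsub.
exists f => w w_lang v; rewrite (hf _ (ex_intro2 _ _ w w_lang erefl)) /arg /= bcodeK.
split=> [/bcode_inj->|[t ht ->]].
  by exists (tau w); first exact: tauP.
by rewrite (us_nrep_inj hS (Uval_fun ht (tauP _ w_lang))).
Qed.

Lemma turing_submachine_total Q :
  lang S Q -> total_program S Q -> turing_submachine S Q.
Proof.
move=> Q_lang Q_total; split=> //.
  move=> w /Q_total[t ht]; exists (lstr S (sub_index S t w)).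
  split; first by exists t.
  by move=> v [t' ht' ->]; rewrite (us_nrep_inj hS (Uval_fun ht ht')).
have [f hf] := computable_submachine Q_lang Q_total.
(* Universality turns [f] into a program; as every number is the code of a string, no value of [f]
   is lost in passing to strings. *)
have [|M M_lang MP] := us_universal hS
    (k := 1) (F := fun ws v => rsem f (map bcode ws) (bcode v)).
  exists f => ws y _; split=> [|[v hv ->]//].
  by have [v <-] := bcode_surj y; exists v.
by exists M => // w v w_lang; rewrite -hf // (MP [:: w]).
Qed.

End Submachine.

(** * Totality of the self-referential time bound *)

Lemma binval_ge0 s : (0 <= binval s)%R.
Proof.
apply: Num.Theory.sumr_ge0 => i _; apply: Num.Theory.divr_ge0.
  exact: Num.Theory.ler0n.
by apply: Num.Theory.exprn_ge0.
Qed.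

(** A program is strictly longer than each of its inputs. Positivity makes [(size w).-1] strictly
    smaller than [size w], as the induction requires. *)
Lemma size_Omega_prog (R : realType) (S : setting) (piO Q rho : bits) :
  universal_setting R S -> lang S piO -> 0 < size (Omega_prog S piO Q rho).
Proof.
move=> hS piO_lang; have [eps [C' [C [_ hsize _ _]]]] := us_size_bounds hS.
have := hsize piO [:: Q; unary rho; rho] rho piO_lang.
by rewrite !inE eqxx !orbT => /(_ isT); apply: leq_ltn_trans.
Qed.

Theorem theorem10p1 (R : realType) (S : setting)
    (T Psum piOmega Pstar Pstar2 PT : bits)
    (hS : universal_setting R S)
    (T_lang : lang S T) (hT : is_T S T)
    (Psum_lang : lang S Psum) (hPsum : is_Psum S Psum)
    (piOmega_lang : lang S piOmega) (hpiOmega : is_piOmega S piOmega)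
    (Pstar_lang : lang S Pstar) (hPstar : is_Pstar S T Psum piOmega Pstar)
    (Pstar2_lang : lang S Pstar2) (hPstar2 : is_Pstar2 S Pstar Pstar2)
    (PT_lang : lang S PT) (hPT : total_program S PT) :
  (forall w : bits, lang S w ->
     exists t : nat, Uval S (apps S Pstar2 [:: PT; w]) (nrep S t))
  /\ turing_submachine S (apps S Pstar2 [:: PT]).
Proof.
have [app_lang _ _ _ _] := us_functionalizable hS.
set Q := apps S Pstar2 [:: PT].
have Q_lang : lang S Q by apply: app_lang.
suff Q_total : total_program S Q.
  by split; [exact: Q_total | exact: turing_submachine_total hS _ Q_lang Q_total].
move=> w; have [n] := ubnP (size w); elim: n w => // n IHn w lt_wn w_lang.
(* [app S Q w] unfolds to [apps S Pstar2 [:: PT; w]], to which the self-reference equation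
   applies. *)
suff [t ht] : exists t, Uval S (apps S Pstar [:: Q; PT; w]) (nrep S t).
  by exists t; apply: (hPstar2 PT w (nrep S t) PT_lang w_lang).2.
have [t' ht'] := hPT w w_lang.
case: (pselect (exists rho, w = Omega_prog S piOmega Q rho)) => [[rho wE]|no_rho];
  last by exists t'; apply/hPstar => //; left.
have w_gt0 : 0 < size w by rewrite wE; apply: size_Omega_prog hS _.
set N := (size w).-1.
(* Programs of size at most [N] are shorter than [w], so the induction hypothesis gives their
   bounds; elsewhere the value 0 is arbitrary. *)
have [tau tauP] : exists tau, time_bounds S Q N tau.
  have [|tau tauP] := @choice _ _ (fun p t => lang S p -> size p <= N ->
      Uval S (app S Q p) (nrep S t)); last by exists tau.
  move=> p; case: (boolP (lang S p && (size p <= N))) => [/andP[p_lang le_pN]|].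
    have [|t ht] := IHn p _ p_lang; last by exists t.
    by rewrite (leq_ltn_trans le_pN) // /N prednK.
  by move=> /negP no; exists 0 => p_lang le_pN; case: no; rewrite p_lang.
have [r hr rE] : exists2 r, Uval S (apps S Psum [:: Q; nrep S N]) r &
    binval r = if N is 0 then 0%R else halting_sum S tau N.
  by apply/hPsum => //; case: (N) tauP => // m tauP; exists tau.
have [lt_r|le_r] := Order.TotalTheory.ltP (binval r) (binval rho).
  by exists t'; apply/hPstar => //; right; exists rho, r; split=> //; left.
have [t ht] : exists t, tm_time (univ S) w t.
  suff [v hv] : exists v, Uval S w v by apply: tm_value_time hv.
  rewrite wE; case: (eqVneq (binval rho) 0%R) => [rho0|rho_n0].
    by exists (lstr S 0); apply/hpiOmega => //; left.
  (* For [N = 0] the sum returned is 0, which would force [binval rho] to be 0. *)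
  have N_gt0 : 0 < N.
    case: (N) rE => // r0; case/eqP: rho_n0.
    by apply/Order.POrderTheory.le_anti; rewrite binval_ge0 -r0 le_r.
  (* The search made by [w] stops at the least such [k]; as [N] is a witness, [k <= N], and the
     bounds in [tau] cover every program that the search consults. *)
  have ex_k : exists k, (0 < k) && (binval rho <= halting_sum S tau k)%R.
    by exists N; rewrite N_gt0 /=; case: (N) N_gt0 rE => // m _ <-.
  case: (ex_minnP ex_k) => k /andP[k_gt0 rho_k] min_k.
  have le_kN : k <= N.
    by apply: min_k; rewrite N_gt0 /=; case: (N) N_gt0 rE => // m _ <-.
  exists (lstr S (max_sub_index S tau k).+1); apply/hpiOmega => //; right.
  split; first exact/eqP.
  exists k, tau; split=> //.
    by move=> p p_lang le_pk; apply: tauP => //; apply: leq_trans le_pk le_kN.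
  move=> j /andP[j_gt0 lt_jk]; rewrite Order.TotalTheory.ltNge.
  by apply: contraL lt_jk => rho_j; rewrite -leqNgt min_k // j_gt0.
exists (if t' < t then t else t'); apply/hPstar => //; right.
exists rho, r; split=> //; right; split=> //; exists t, t'; split=> //.
by apply/hT => //; exists t.
Qed.
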